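(* Let $\mathbb{K}$ be a field of characteristic $\neq 2$ and $n\ge 0$. For every $a\in Cl(n,n)$, $$F_n(a)^T=F_n(\beta(a^* )),$$ and consequently $$F_n(a^* )=\hat\beta\bigl(F_n(a)^T\bigr),\qquad\text{where } \hat\beta=F_n\circ\beta\circ F_n^{-1}: M_{2^n}(\mathbb{K})\to M_{2^n}(\mathbb{K}).$$ Furthermore, there is an algorithm which, for $n\ge1$, computes the matrix $F_n(a^* )$ from the matrix $F_n(a)$ using $O(n\cdot 4^n)$ operations.
   Context: $Cl(n,n)$ is the Clifford algebra over $\mathbb{K}$ generated by pairwise anticommuting basis vectors $e_0,\dots,e_{n-1}$ (each squaring to $1$) and $\tilde e_0,\dots,\tilde e_{n-1}$ (each squaring to $-1$). $Cl(n-1,n-1)\subset Cl(n,n)$ is the subalgebra generated by the basis vectors with indices $0,\dots,n-2$. $\alpha$ is the parity automorphism: the algebra automorphism sending every basis vector $v$ to $-v$. $\beta$ is the algebra automorphism with $\beta(e_i)=e_i$ and $\beta(\tilde e_i)=-\tilde e_i$ for all $i$. $a^*$ is the reversal of $a$, i.e. $a\mapsto a^*$ is the $\mathbb{K}$-linear algebra antiautomorphism fixing every basis vector. $T$ denotes the matrix transpose. The maps $F_n: Cl(n,n)\to M_{2^n}(\mathbb{K})$ (which are algebra isomorphisms) are defined recursively by $F_0(a)=(a)$ for $a\in Cl(0,0)=\mathbb{K}$ and, for $n\ge 1$ and $A_{ij}\in Cl(n-1,n-1)$, $$F_n(A_{00}+e_{n-1}A_{01}+\tilde e_{n-1}A_{10}+\tilde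 e_{n-1}e_{n-1}A_{11})=\begin{bmatrix}F_{n-1}(A_{00}+A_{11}) & F_{n-1}(\alpha(A_{01}+A_{10}))\\ F_{n-1}(A_{01}-A_{10}) & F_{n-1}(\alpha(A_{00}-A_{11}))\end{bmatrix}.$$ An operation means moving a matrix entry, changing its sign, or an arithmetic operation in $\mathbb{K}$, each at unit cost; the constant in $O(\cdot)$ is absolute. *)

(* Defs.v *)
From HB Require Import structures.
From mathcomp Require Import all_boot all_order all_algebra.

Set Implicit Arguments.
Unset Strict Implicit.
Unset Printing Implicit Defensive.

Import GRing.Theory.
Local Open Scope ring_scope.

Section Blades.

Variables (K : fieldType) (m : nat).

Implicit Types (S T U : {set 'I_m}) (i j : 'I_m).

(* The Clifford algebra on anticommuting basis vectors v_0, ..., v_(m-1), where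
   v_i squares to 1 if i is even and to -1 if i is odd.  An element is given by
   its coefficients in the basis of blades; the blade of S is the product of
   the v_i, i in S, taken by decreasing index (lemma blade_prod). *)
Definition cliff := {ffun {set 'I_m} -> K}.

HB.instance Definition _ := GRing.Lmodule.copy cliff {ffun {set 'I_m} -> K^o}.

Definition blade S : cliff := [ffun U => (U == S)%:R].

Definition symdiff S T : {set 'I_m} := [set x | (x \in S) (+) (x \in T)].

(* Bringing the product of the blades of S and T to decreasing order costs one
   sign for each pair (i, j) with i < j that has to be swapped, and one sign for
   each contracted square v_i * v_i = -1. *)
Definition blade_sign S T : K :=
  \prod_(i in S) \prod_(j in T) (-1) ^+ ((i < j)%N || (i == j) && odd i).

End Blades.

Arguments blade {K m} S.

(* Locked, lest unification expand products into double sums. *)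
HB.lock Definition cliff_mul (K : fieldType) (m : nat) (a b : cliff K m) :
    cliff K m :=
  \sum_S \sum_T (a S * b T * blade_sign K S T) *: blade (symdiff S T).

Section CliffordAlgebra.

Variables (K : fieldType) (m : nat).

Implicit Types (S T U : {set 'I_m}) (i j : 'I_m).

Local Notation cliff := (cliff K m).
Local Notation cliff_mul := (@cliff_mul K m).
Local Notation blade_sign := (@blade_sign K m).
Local Notation blade := (@blade K m).

Lemma cliffE (a : cliff) : a = \sum_S a S *: blade S.
Proof.
apply/ffunP => U; rewrite sum_ffunE (bigD1 U) //= !ffunE eqxx.
rewrite big1 => [|S nSU]; first by rewrite addr0 /GRing.scale /= mulr1.
by rewrite !ffunE eq_sym (negPf nSU) /GRing.scale /= mulr0.
Qed.

Lemma cliff_mulDl : left_distributive cliff_mul +%R.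
Proof.
move=> a b c; rewrite cliff_mul.unlock -big_split; apply: eq_bigr => S _ /=.
rewrite -big_split; apply: eq_bigr => T _ /=.
by rewrite ffunE !mulrDl scalerDl.
Qed.

Lemma cliff_mulDr : right_distributive cliff_mul +%R.
Proof.
move=> a b c; rewrite cliff_mul.unlock -big_split; apply: eq_bigr => S _ /=.
rewrite -big_split; apply: eq_bigr => T _ /=.
by rewrite ffunE mulrDr !mulrDl scalerDl.
Qed.

Lemma cliff_mulZl k (a b : cliff) : k *: cliff_mul a b = cliff_mul (k *: a) b.
Proof.
rewrite cliff_mul.unlock scaler_sumr; apply: eq_bigr => S _ /=.
rewrite scaler_sumr; apply: eq_bigr => T _ /=.
by rewrite ffunE scalerA /GRing.scale /= !mulrA.
Qed.

Lemma cliff_mulZr k (a b : cliff) : k *: cliff_mul a b = cliff_mul a (k *: b).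
Proof.
rewrite cliff_mul.unlock scaler_sumr; apply: eq_bigr => S _ /=.
rewrite scaler_sumr; apply: eq_bigr => T _ /=.
by rewrite ffunE scalerA /GRing.scale /= !mulrA [k * a S]mulrC.
Qed.

Lemma cliff_mul0l b : cliff_mul 0 b = 0.
Proof. by rewrite -[0 in LHS](scale0r 0) -cliff_mulZl scale0r. Qed.

Lemma cliff_mul0r a : cliff_mul a 0 = 0.
Proof. by rewrite -[0 in LHS](scale0r 0) -cliff_mulZr scale0r. Qed.

Lemma cliff_mul_suml I (r : seq I) (P : pred I) (a : I -> cliff) b :
  cliff_mul (\sum_(i <- r | P i) a i) b = \sum_(i <- r | P i) cliff_mul (a i) b.
Proof.
exact: (big_morph (cliff_mul^~ b) (fun x y => cliff_mulDl x y b) (cliff_mul0l b)).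
Qed.

Lemma cliff_mul_sumr I (r : seq I) (P : pred I) (a : I -> cliff) b :
  cliff_mul b (\sum_(i <- r | P i) a i) = \sum_(i <- r | P i) cliff_mul b (a i).
Proof. exact: (big_morph _ (cliff_mulDr b) (cliff_mul0r b)). Qed.

Lemma cliff_mul_blade S T :
  cliff_mul (blade S) (blade T) = blade_sign S T *: blade (symdiff S T).
Proof.
rewrite cliff_mul.unlock (bigD1 S) //= (bigD1 T) //= !ffunE !eqxx !mul1r.
rewrite big1 => [|T' /negPf nT]; last by rewrite !ffunE nT mulr0 mul0r scale0r.
rewrite big1 ?addr0 // => S' /negPf nS.
by rewrite big1 // => T' _; rewrite !ffunE nS !mul0r scale0r.
Qed.

Lemma symdiffA : associative (@symdiff m).
Proof. by move=> S T U; apply/setP => x; rewrite !inE addbA. Qed.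

Lemma prod_symdiff (f : 'I_m -> K) S T : (forall i, f i * f i = 1) ->
  \prod_(i in symdiff S T) f i = \prod_(i in S) f i * \prod_(i in T) f i.
Proof.
move=> f2; rewrite big_mkcond [X in X * _]big_mkcond [X in _ * X]big_mkcond.
rewrite -big_split; apply: eq_bigr => i _ /=; rewrite inE.
by case: (i \in S); case: (i \in T); rewrite ?mulr1 ?mul1r ?f2.
Qed.

Lemma blade_sign_symdiffl S T U :
  blade_sign (symdiff S T) U = blade_sign S U * blade_sign T U.
Proof.
apply: prod_symdiff => i; rewrite -big_split big1 // => j _ /=.
by rewrite -expr2 sqrr_sign.
Qed.

Lemma blade_sign_symdiffr S T U :
  blade_sign S (symdiff T U) = blade_sign S T * blade_sign S U.
Proof.
rewrite /blade_sign -big_split; apply: eq_bigr => i _ /=.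
by apply: prod_symdiff => j; rewrite -expr2 sqrr_sign.
Qed.

Lemma blade_mulA S T U :
  cliff_mul (blade S) (cliff_mul (blade T) (blade U)) =
  cliff_mul (cliff_mul (blade S) (blade T)) (blade U).
Proof.
rewrite !cliff_mul_blade -cliff_mulZl -cliff_mulZr !cliff_mul_blade !scalerA.
by rewrite symdiffA blade_sign_symdiffl blade_sign_symdiffr mulrC mulrA.
Qed.

Lemma cliff_mulA : associative cliff_mul.
Proof.
move: cliff_mul_suml cliff_mul_sumr cliff_mulZl cliff_mulZr blade_mulA.
move: cliff_mul => mul suml sumr Zl Zr bA a b c.
rewrite (cliffE a) !suml; apply: eq_bigr => S _; rewrite -!Zl; congr (_ *: _).
rewrite (cliffE b) suml !sumr suml; apply: eq_bigr => T _.
rewrite -Zl -!Zr -Zl; congr (_ *: _).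
rewrite (cliffE c) !sumr; apply: eq_bigr => U _.
by rewrite -!Zr bA.
Qed.

Lemma blade_sign0l S : blade_sign set0 S = 1.
Proof. by rewrite /blade_sign big_set0. Qed.

Lemma blade_sign0r S : blade_sign S set0 = 1.
Proof. by rewrite /blade_sign big1 // => i _; rewrite big_set0. Qed.

Lemma cliff_mul1l : left_id (blade set0) cliff_mul.
Proof.
move=> a; rewrite {1}(cliffE a) cliff_mul_sumr [RHS]cliffE.
apply: eq_bigr => S _; rewrite -cliff_mulZr cliff_mul_blade blade_sign0l scale1r.
by congr (_ *: blade _); apply/setP => x; rewrite !inE.
Qed.

Lemma cliff_mul1r : right_id (blade set0) cliff_mul.
Proof.
move=> a; rewrite {1}(cliffE a) cliff_mul_suml [RHS]cliffE.
apply: eq_bigr => S _; rewrite -cliff_mulZl cliff_mul_blade blade_sign0r scale1r.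
by congr (_ *: blade _); apply/setP => x; rewrite !inE addbF.
Qed.

Lemma cliff_1neq0 : blade set0 != 0.
Proof.
by apply/eqP => /ffunP/(_ set0)/eqP; rewrite !ffunE eqxx oner_eq0.
Qed.

HB.instance Definition _ := GRing.Zmodule_isNzRing.Build cliff
  cliff_mulA cliff_mul1l cliff_mul1r cliff_mulDl cliff_mulDr cliff_1neq0.
HB.instance Definition _ := GRing.Lmodule_isLalgebra.Build K cliff cliff_mulZl.
HB.instance Definition _ := GRing.Lalgebra_isAlgebra.Build K cliff cliff_mulZr.

Definition gen i : cliff := blade [set i].

Definition ords_desc : seq 'I_m := rev (enum 'I_m).

(* The algebra morphism with v_i |-> f i, if the f i satisfy the defining
   relations (cliff_ext_monoid_morphism, cliff_ext_unique). *)
Definition cliff_ext (B : algType K) (f : 'I_m -> B) (a : cliff) : B :=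
  \sum_S a S *: \prod_(i <- ords_desc | i \in S) f i.

(* The parity automorphism. *)
Definition alpha : cliff -> cliff := cliff_ext (fun i => - gen i).

Definition beta : cliff -> cliff :=
  cliff_ext (fun i => if odd i then - gen i else gen i).

(* The blades are products by decreasing index, here reversed. *)
Definition reversal (a : cliff) : cliff :=
  \sum_S a S *: \prod_(i <- enum 'I_m | i \in S) gen i.

Lemma cliff_ext_is_linear (B : algType K) (f : 'I_m -> B) :
  linear (cliff_ext f).
Proof.
move=> k a b; rewrite /cliff_ext scaler_sumr -big_split; apply: eq_bigr => S _.
by rewrite !ffunE scalerDl scalerA.
Qed.

HB.instance Definition _ (B : algType K) (f : 'I_m -> B) :=
  GRing.isLinear.Build K cliff B _ (cliff_ext f) (cliff_ext_is_linear f).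
HB.instance Definition _ := GRing.Linear.on alpha.
HB.instance Definition _ := GRing.Linear.on beta.

Lemma cliff_ext_blade (B : algType K) (f : 'I_m -> B) S :
  cliff_ext f (blade S) = \prod_(i <- ords_desc | i \in S) f i.
Proof.
rewrite /cliff_ext (bigD1 S) //= ffunE eqxx scale1r.
rewrite [X in _ + X]big1 ?addr0 // => T nTS.
by rewrite ffunE (negPf nTS) scale0r.
Qed.

Lemma mem_ords_desc i : i \in ords_desc.
Proof. by rewrite mem_rev mem_enum. Qed.

Lemma ords_desc_uniq : uniq ords_desc.
Proof. by rewrite rev_uniq enum_uniq. Qed.

Lemma ords_desc_sorted : sorted (fun i j => (j < i)%N) ords_desc.
Proof.
rewrite /ords_desc rev_sorted -(@sorted_map _ _ val ltn).
by rewrite val_enum_ord iota_ltn_sorted.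
Qed.

Section UniversalProperty.

Variables (B : algType K) (f : 'I_m -> B).

Lemma cliff_ext_gen i : cliff_ext f (gen i) = f i.
Proof.
rewrite cliff_ext_blade; under eq_bigl do rewrite in_set1.
rewrite -big_filter (filter_pred1_uniq ords_desc_uniq (mem_ords_desc i)).
by rewrite big_seq1.
Qed.

Hypothesis fsq : forall i, f i * f i = (-1) ^+ odd i.
Hypothesis fanti : forall i j, i != j -> f i * f j = - (f j * f i).

Let mono (s : seq 'I_m) S := \prod_(i <- s | i \in S) f i.

Lemma mul_gen_mono i (s : seq 'I_m) S :
    sorted (fun i j => (j < i)%N) s -> i \in s ->
  f i * mono s S =
    (\prod_(j <- s | j \in S) (-1) ^+ ((i < j)%N || (i == j) && odd i) : K)
      *: mono s (symdiff [set i] S).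
Proof.
rewrite /mono; elim: s => // x s IHs.
rewrite /= path_sortedE; last by move=> j k l jk kl; exact: ltn_trans kl jk.
move=> /andP[/allP ltx sorted_s].
rewrite in_cons !big_cons inE in_set1 [x == i]eq_sym.
have [eq_ix _|nix /= s_i] := eqVneq i x.
  move: ltx; rewrite -eq_ix ltnn /= => ltx.
  have Es : \prod_(j <- s | j \in S)
      (-1) ^+ ((i < j)%N || (i == j) && odd i) = 1 :> K.
    rewrite big1_seq // => j /andP[_ /ltx ltji].
    rewrite ltnNge ltnW //= (_ : i == j = false) //.
    by apply: contraTF ltji => /eqP->; rewrite ltnn.
  have Em : \prod_(j <- s | j \in symdiff [set i] S) f j =
            \prod_(j <- s | j \in S) f j.
    rewrite big_seq_cond [RHS]big_seq_cond; apply: eq_bigl => j.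
    case s_j: (j \in s) => //=; rewrite inE in_set1.
    rewrite (_ : j == i = false) //.
    by apply: contraTF (ltx _ s_j) => /eqP->; rewrite ltnn.
  rewrite Es Em; case: ifP => _ /=; last by rewrite scale1r.
  by rewrite mulrA fsq mulr1; case: odd;
     rewrite ?expr1 ?expr0 ?scaleN1r ?mulN1r ?scale1r ?mul1r.
have ltix: (i < x)%N by apply: ltx.
rewrite ltix /=; case: ifP => _; last exact: IHs.
by rewrite mulrA fanti // mulNr -mulrA IHs // -scalerAr expr1 mulN1r scaleNr.
Qed.

Lemma blade_sign1 i S :
  blade_sign [set i] S =
    \prod_(j <- ords_desc | j \in S) (-1) ^+ ((i < j)%N || (i == j) && odd i).
Proof.
rewrite /blade_sign big_set1 [RHS](perm_big (enum 'I_m)) ?perm_rev //.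
by rewrite /= big_enum_cond.
Qed.

Lemma blade_sign_sqr S T : blade_sign S T * blade_sign S T = 1.
Proof.
rewrite -big_split big1 // => i _ /=; rewrite -big_split big1 // => j _ /=.
by rewrite -expr2 sqrr_sign.
Qed.

Lemma mul_mono S T :
  mono ords_desc S * mono ords_desc T =
    blade_sign S T *: mono ords_desc (symdiff S T).
Proof.
have mulg i U := mul_gen_mono U ords_desc_sorted (mem_ords_desc i).
move: {2}#|S| (leqnn #|S|) => k; elim: k S => [|k IHk] S.
  rewrite leqn0 cards_eq0 => /eqP->; rewrite blade_sign0l scale1r.
  rewrite {1}/mono big1 ?mul1r => [|i]; last by rewrite inE.
  by congr mono; apply/setP => x; rewrite !inE.
have [-> _|[i S_i]] := set_0Vmem S; first by apply: IHk; rewrite cards0.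
rewrite (cardsD1 i) S_i ltnS => /IHk IH; set S' := S :\ i in IH.
have defS : S = symdiff [set i] S'.
  apply/setP => x; rewrite !inE.
  by have [->|] := eqVneq x i; rewrite ?S_i //= (addFb).
have monoS : mono ords_desc S =
    blade_sign [set i] S' *: (f i * mono ords_desc S').
  by rewrite mulg -blade_sign1 scalerA blade_sign_sqr scale1r -defS.
rewrite monoS -scalerAl -mulrA IH -scalerAr mulg -blade_sign1 symdiffA -defS.
have -> : blade_sign S T = blade_sign [set i] T * blade_sign S' T.
  by rewrite {1}defS blade_sign_symdiffl.
rewrite blade_sign_symdiffr !scalerA; congr (_ *: _).
rewrite -mulrA mulrCA (mulrA (blade_sign [set i] S')) blade_sign_sqr mul1r.
by rewrite mulrC.
Qed.

Lemma cliff_ext_monoid_morphism : monoid_morphism (cliff_ext f).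
Proof.
split=> [|a b].
  by rewrite cliff_ext_blade big1 // => i; rewrite inE.
rewrite [in LHS](cliffE a) [in LHS](cliffE b) mulr_suml linear_sum.
rewrite [in RHS]/cliff_ext mulr_suml; apply: eq_bigr => S _.
rewrite !mulr_sumr linear_sum; apply: eq_bigr => T _.
rewrite -!scalerAl -!scalerAr !linearZ /=.
rewrite [blade S * blade T]cliff_mul_blade [cliff_ext f _]linearZ /=.
by rewrite cliff_ext_blade -!/(mono _ _) mul_mono !scalerA [a S * b T]mulrC.
Qed.

End UniversalProperty.

Lemma gen_sqr i : gen i * gen i = (-1) ^+ odd i.
Proof.
rewrite [LHS]cliff_mul_blade /blade_sign !big_set1 ltnn eqxx /=.
rewrite (_ : symdiff _ _ = set0); last by apply/setP => x; rewrite !inE addbb.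
by rewrite (_ : blade set0 = 1) //; case: odd; rewrite ?scaleN1r ?scale1r.
Qed.

Lemma gen_anticomm i j : i != j -> gen i * gen j = - (gen j * gen i).
Proof.
move=> nij; rewrite [gen i * _]cliff_mul_blade [gen j * _]cliff_mul_blade.
rewrite /blade_sign !big_set1 [j == i]eq_sym (negPf nij) /= !orbF -scaleNr.
congr (_ *: blade _); last by apply/setP => x; rewrite !inE addbC.
move: nij; rewrite -val_eqE neq_ltn => /orP[] ltij.
  by rewrite ltij ltnNge ltnW.
by rewrite ltij ltnNge ltnW //= expr1 opprK.
Qed.

Lemma blade_prod S : blade S = \prod_(i <- ords_desc | i \in S) gen i.
Proof.
have mulg i U :=
  mul_gen_mono gen_sqr gen_anticomm U ords_desc_sorted (mem_ords_desc i).
move: {2}#|S| (leqnn #|S|) => k; elim: k S => [|k IHk] S.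
  by rewrite leqn0 cards_eq0 => /eqP->; rewrite big1 // => i; rewrite inE.
have [-> _|[i S_i]] := set_0Vmem S; first by apply: IHk; rewrite cards0.
rewrite (cardsD1 i) S_i ltnS => /IHk IH; set S' := S :\ i in IH.
have defS : S = symdiff [set i] S'.
  apply/setP => x; rewrite !inE.
  by have [->|] := eqVneq x i; rewrite ?S_i //= (addFb).
have := mulg i S'; rewrite -IH -blade_sign1 -defS.
rewrite [gen i * _]cliff_mul_blade -defS => /(congr1 ( *:%R (blade_sign [set i] S'))).
by rewrite !scalerA blade_sign_sqr !scale1r.
Qed.

Lemma cliff_ext_unique (B : algType K) (g : {lrmorphism cliff -> B}) :
  g =1 cliff_ext (fun i => g (gen i)).
Proof.
move=> a; rewrite {1}(cliffE a) linear_sum; apply: eq_bigr => S _.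
by rewrite linearZ /= blade_prod rmorph_prod.
Qed.

Lemma alpha_monoid_morphism : monoid_morphism alpha.
Proof.
apply: cliff_ext_monoid_morphism => [i|i j nij].
  by rewrite mulrNN gen_sqr.
by rewrite !mulrNN gen_anticomm.
Qed.

Lemma beta_monoid_morphism : monoid_morphism beta.
Proof.
apply: cliff_ext_monoid_morphism => [i|i j nij].
  by case: ifP => Oi; rewrite ?mulrNN gen_sqr ?Oi.
by do 2!case: ifP => _; rewrite ?mulrNN ?mulrN ?mulNr gen_anticomm.
Qed.

HB.instance Definition _ :=
  GRing.isMonoidMorphism.Build cliff cliff alpha alpha_monoid_morphism.
HB.instance Definition _ :=
  GRing.isMonoidMorphism.Build cliff cliff beta beta_monoid_morphism.

Lemma alpha_gen i : alpha (gen i) = - gen i.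
Proof. exact: cliff_ext_gen. Qed.

Lemma beta_gen i : beta (gen i) = if odd i then - gen i else gen i.
Proof. exact: cliff_ext_gen. Qed.

Lemma alphaK : involutive alpha.
Proof.
move=> a; have := cliff_ext_unique (alpha \o alpha) a => /= ->.
rewrite [RHS](cliff_ext_unique idfun); apply: eq_bigr => S _; congr (_ *: _).
by apply: eq_bigr => i _; rewrite /= alpha_gen linearN /= alpha_gen opprK.
Qed.

Lemma reversal_is_linear : linear reversal.
Proof.
move=> k a b; rewrite /reversal scaler_sumr -big_split; apply: eq_bigr => S _.
by rewrite !ffunE scalerDl scalerA.
Qed.

HB.instance Definition _ :=
  GRing.isLinear.Build K cliff cliff _ reversal reversal_is_linear.

Local Notation cliffc := (cliff^c).
HB.instance Definition _ := GRing.Zmodule_isLmodule.Build K cliffc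
  (@scalerA K cliff) (@scale1r K cliff) (@scalerDr K cliff)
  (fun v a b => @scalerDl K cliff v a b).
HB.instance Definition _ := GRing.Lmodule_isLalgebra.Build K cliffc
  (fun k a b => @scalerAr K cliff k b a).
HB.instance Definition _ := GRing.Lalgebra_isAlgebra.Build K cliffc
  (fun k a b => @scalerAl K cliff k b a).

Lemma reversal_ext a : reversal a = cliff_ext (gen : _ -> cliffc) a.
Proof.
by apply: eq_bigr => S _; rewrite rev_prodr /ords_desc revK.
Qed.

Lemma reversal_antimorphism : monoid_morphism (reversal : cliff -> cliffc).
Proof.
have [|i j nij|E1 EM] := @cliff_ext_monoid_morphism cliffc gen.
- by move=> i; have := gen_sqr i; case: odd.
- by rewrite eq_sym in nij; exact: (gen_anticomm nij).
by split=> [|a b]; rewrite !reversal_ext ?E1 ?EM.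
Qed.

Lemma reversal1 : reversal 1 = 1.
Proof. exact: reversal_antimorphism.1. Qed.

Lemma reversalM a b : reversal (a * b) = reversal b * reversal a.
Proof. exact: reversal_antimorphism.2. Qed.

Lemma reversal_gen i : reversal (gen i) = gen i.
Proof. by rewrite reversal_ext (@cliff_ext_gen cliffc). Qed.

End CliffordAlgebra.

Arguments gen {K m} i.
Arguments alpha {K m} a.
Arguments beta {K m} a.
Arguments reversal {K m} a.

(* The 2n basis vectors of Cl(n,n) are ordered as e_0, et_0, e_1, et_1, ... *)
Notation Cl K n := (cliff K n.*2).

Section SplitSignature.

Variable K : fieldType.
Implicit Types n : nat.

Fact e_ord_subproof n (i : 'I_n) : (i.*2 < n.*2)%N.
Proof. by rewrite ltn_double. Qed.

Fact et_ord_subproof n (i : 'I_n) : (i.*2.+1 < n.*2)%N.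
Proof. by rewrite -doubleS leq_double. Qed.

Definition e_ord n (i : 'I_n) : 'I_n.*2 := Ordinal (e_ord_subproof i).
Definition et_ord n (i : 'I_n) : 'I_n.*2 := Ordinal (et_ord_subproof i).

Definition e n (i : 'I_n) : Cl K n := gen (e_ord i).
Definition et n (i : 'I_n) : Cl K n := gen (et_ord i).

Lemma e_sqr n (i : 'I_n) : e i * e i = 1.
Proof. by rewrite gen_sqr /= odd_double. Qed.

Lemma et_sqr n (i : 'I_n) : et i * et i = - 1.
Proof. by rewrite gen_sqr /= odd_double. Qed.

Lemma e_anticomm n (i j : 'I_n) : i != j -> e i * e j = - (e j * e i).
Proof. by move=> nij; apply: gen_anticomm; rewrite -val_eqE /= (inj_eq double_inj). Qed.

Lemma et_anticomm n (i j : 'I_n) : i != j -> et i * et j = - (et j * et i).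
Proof.
by move=> nij; apply: gen_anticomm; rewrite -val_eqE /= eqSS (inj_eq double_inj).
Qed.

Lemma e_et_anticomm n (i j : 'I_n) : e i * et j = - (et j * e i).
Proof.
apply: gen_anticomm; rewrite -val_eqE /=.
by apply/eqP => /(congr1 odd); rewrite /= !odd_double.
Qed.

Lemma alpha_e n (i : 'I_n) : alpha (e i) = - e i.
Proof. exact: alpha_gen. Qed.

Lemma alpha_et n (i : 'I_n) : alpha (et i) = - et i.
Proof. exact: alpha_gen. Qed.

Lemma beta_e n (i : 'I_n) : beta (e i) = e i.
Proof. by rewrite beta_gen /= odd_double. Qed.

Lemma beta_et n (i : 'I_n) : beta (et i) = - et i.
Proof. by rewrite beta_gen /= odd_double. Qed.

Lemma reversal_e n (i : 'I_n) : reversal (e i) = e i.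
Proof. exact: reversal_gen. Qed.

Lemma reversal_et n (i : 'I_n) : reversal (et i) = et i.
Proof. exact: reversal_gen. Qed.

Section Split.

Variable n : nat.
Implicit Types (S : {set 'I_n.*2}) (U : {set 'I_n.+1.*2}) (s t : bool).

Definition ord_up : 'I_n.*2 -> 'I_n.+1.*2 :=
  widen_ord (leqW (leqnSn n.*2)).

(* The inclusion of Cl(n,n) into Cl(n+1,n+1). *)
Definition incl : Cl K n -> Cl K n.+1 := cliff_ext (fun i => gen (ord_up i)).

Definition embed t s S : {set 'I_n.+1.*2} :=
  (if t then [set et_ord ord_max] else set0)
  :|: (if s then [set e_ord ord_max] else set0) :|: [set ord_up i | i in S].

(* The coefficient A_ts in the unique decomposition (split_coef, coef_split)
   a = A_00 + e_n A_01 + et_n A_10 + et_n e_n A_11 of a : Cl K n.+1. *)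
Definition coef t s (a : Cl K n.+1) : Cl K n := [ffun S => a (embed t s S)].

Lemma incl_monoid_morphism : monoid_morphism incl.
Proof.
apply: cliff_ext_monoid_morphism => [i|i j nij]; first exact: gen_sqr.
exact: gen_anticomm.
Qed.

HB.instance Definition _ := GRing.Linear.on incl.
HB.instance Definition _ :=
  GRing.isMonoidMorphism.Build (Cl K n) (Cl K n.+1) incl incl_monoid_morphism.

Lemma incl_gen i : incl (gen i) = gen (ord_up i).
Proof. exact: cliff_ext_gen. Qed.

Lemma ord_up_inj : injective ord_up.
Proof. by move=> i j /(congr1 val) /= /val_inj. Qed.

Lemma in_up i S : (ord_up i \in [set ord_up j | j in S]) = (i \in S).
Proof. exact: mem_imset ord_up_inj. Qed.

Lemma incl_blade S : incl (blade S) = blade [set ord_up i | i in S].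
Proof.
rewrite [LHS]cliff_ext_blade blade_prod -[LHS]big_filter -[RHS]big_filter.
rewrite -(big_map ord_up xpredT gen).
have gtn_tr k : transitive (fun i j : 'I_k => (j < i)%N).
  by move=> j i l ltji ltlj; apply: ltn_trans ltlj ltji.
rewrite (_ : [seq ord_up i | i <- _] =
  [seq i <- ords_desc n.+1.*2 | i \in [set ord_up i | i in S]]) //.
apply: (@irr_sorted_eq _ (fun i j : 'I_n.+1.*2 => (j < i)%N)) => [||||i].
- exact: gtn_tr.
- by move=> i; apply: ltnn.
- rewrite sorted_map; apply: sorted_filter; first exact: gtn_tr.
  exact: ords_desc_sorted.
- by apply: sorted_filter; [exact: gtn_tr|exact: ords_desc_sorted].
rewrite mem_filter mem_ords_desc andbT; apply/mapP/imsetP => -[j].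
  by rewrite mem_filter => /andP[S_j _] ->; exists j.
by move=> S_j ->; exists j; rewrite // mem_filter S_j mem_ords_desc.
Qed.

Lemma embed_inj t s S t' s' S' :
  embed t s S = embed t' s' S' -> [/\ t = t', s = s' & S = S'].
Proof.
have et_e : (et_ord (@ord_max n) == e_ord ord_max) = false.
  by rewrite -val_eqE /= gtn_eqF.
have et_up i : (et_ord (@ord_max n) == ord_up i) = false.
  by rewrite -val_eqE /= gtn_eqF // ltnS ltnW.
have e_up i : (e_ord (@ord_max n) == ord_up i) = false.
  by rewrite -val_eqE /= gtn_eqF.
have et_S S1 : (et_ord ord_max \in [set ord_up i | i in S1]) = false.
  by apply/imsetP => -[i _ /eqP]; rewrite et_up.
have e_S S1 : (e_ord ord_max \in [set ord_up i | i in S1]) = false.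
  by apply/imsetP => -[i _ /eqP]; rewrite e_up.
have in_b (x y : 'I_n.+1.*2) b :
  (x \in if b then [set y] else set0) = b && (x == y).
  by case: b; rewrite inE.
move=> /setP E; split.
- have:= E (et_ord ord_max).
  by rewrite /embed !inE !in_b et_e !et_S eqxx !andbF !andbT !orbF.
- have:= E (e_ord ord_max).
  by rewrite /embed !inE !in_b [_ == et_ord _]eq_sym et_e !e_S eqxx !andbF !andbT !orbF.
apply/setP => i; have:= E (ord_up i).
rewrite /embed !inE !in_b ![ord_up i == _]eq_sym et_up e_up !andbF.
by rewrite !in_up.
Qed.

Lemma embed_surj U : exists t s S, U = embed t s S.
Proof.
exists (et_ord ord_max \in U), (e_ord ord_max \in U), [set i | ord_up i \in U].
apply/setP => x; rewrite /embed !inE.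
have in_b (y : 'I_n.+1.*2) b :
  (x \in if b then [set y] else set0) = b && (x == y).
  by case: b; rewrite inE.
rewrite !in_b.
have [->|nxt] := eqVneq x (et_ord ord_max).
  rewrite andbT -val_eqE /= gtn_eqF // andbF orbF.
  case: (et_ord ord_max \in U) => //=; apply/esym/imsetP => -[i _ /(congr1 val)].
  by move=> /= E; have:= ltn_ord i; rewrite -E ltnNge leqnSn.
rewrite andbF /=.
have [->|nxe] := eqVneq x (e_ord ord_max).
  rewrite andbT.
  case: (e_ord ord_max \in U) => //=; apply/esym/imsetP => -[i _ /(congr1 val)].
  by move=> /= E; have:= ltn_ord i; rewrite -E ltnn.
rewrite andbF /=.
have ltx : (x < n.*2)%N.
  move: nxt nxe; rewrite -!val_eqE /= => nxt nxe.
  have: (x < n.*2.+2)%N by apply: ltn_ord.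
  rewrite ltnS leq_eqVlt (negPf nxt) /=.
  by rewrite ltnS leq_eqVlt (negPf nxe).
have -> : x = ord_up (Ordinal ltx) by apply: val_inj.
by rewrite in_up inE.
Qed.

Lemma gen_mul_blade m (i : 'I_m) (S : {set 'I_m}) :
    (forall j, j \in S -> (j < i)%N) ->
  gen i * blade S = blade (i |: S) :> cliff K m.
Proof.
move=> ltS; rewrite [LHS]cliff_mul_blade /blade_sign big_set1 big1 => [|j S_j].
  rewrite scale1r; congr blade; apply/setP => x; rewrite !inE.
  by have [->|] := eqVneq x i; case S_x: (_ \in S) => //; have:= ltS _ S_x;
     rewrite ltnn.
have ltji := ltS _ S_j; rewrite ltnNge ltnW //= (_ : i == j = false) //.
by apply: contraTF ltji => /eqP->; rewrite ltnn.
Qed.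

Lemma blade_embed t s S :
  blade (embed t s S) = (if t then et ord_max else 1) *
    ((if s then e ord_max else 1) * incl (blade S)).
Proof.
have up_lt x : x \in [set ord_up i | i in S] -> (x < n.*2)%N.
  by case/imsetP => j _ ->; apply: (ltn_ord j).
have Es : (if s then e ord_max else 1) * incl (blade S) =
    blade ((if s then [set e_ord ord_max] else set0)
           :|: [set ord_up i | i in S]).
  rewrite incl_blade; case: s; last by rewrite mul1r set0U.
  by rewrite gen_mul_blade.
rewrite Es /embed -setUA; case: t; last by rewrite mul1r set0U.
rewrite gen_mul_blade // => j; rewrite inE => /orP[|/up_lt]; last exact: ltnW.
by case: s {Es}; rewrite inE // => /eqP->.
Qed.

Lemma coef_is_linear t s : linear (coef t s).
Proof. by move=> k a b; apply/ffunP => S; rewrite !ffunE. Qed.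

HB.instance Definition _ t s :=
  GRing.isLinear.Build K (Cl K n.+1) (Cl K n) _ (coef t s) (coef_is_linear t s).

Lemma coef_term t s t' s' (a : Cl K n) :
  coef t s ((if t' then et ord_max else 1) *
            ((if s' then e ord_max else 1) * incl a)) =
    if (t == t') && (s == s') then a else 0.
Proof.
rewrite {1}(cliffE a) (linear_sum incl) !mulr_sumr (linear_sum (coef t s)).
have inclZ k b : incl (k *: b) = k *: incl b by apply: linearZ.
apply/ffunP => S; rewrite sum_ffunE; under eq_bigr => T _.
  rewrite /= inclZ -!scalerAr -blade_embed !ffunE; over.
case: ifP => [/andP[/eqP-> /eqP->]|nts].
  rewrite (bigD1 S) //= eqxx big1 => [|T nTS].
    by rewrite addr0 /GRing.scale /= mulr1.
  case: eqP => [/embed_inj[_ _ eTS]|_]; first by rewrite eTS eqxx in nTS.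
  by rewrite /GRing.scale /= mulr0.
rewrite big1 ?ffunE // => T _.
case: eqP => [/embed_inj[tt ss _]|_]; first by rewrite tt ss !eqxx in nts.
by rewrite /GRing.scale /= mulr0.
Qed.

Lemma coef_decomp t s (a b c d : Cl K n) :
  coef t s (incl a + e ord_max * incl b + et ord_max * incl c
            + et ord_max * e ord_max * incl d) =
    if t then (if s then d else c) else (if s then b else a).
Proof.
have:= (coef_term t s false false a, coef_term t s false true b,
        coef_term t s true false c, coef_term t s true true d).
rewrite !mul1r mulrA => E; rewrite !(linearD (coef t s)) /= !E.
by case: t s {E} => -[]; rewrite ?add0r ?addr0.
Qed.

Lemma coefK (a : Cl K n.+1) :
  a = incl (coef false false a) + e ord_max * incl (coef false true a)
      + et ord_max * incl (coef true false a)
      + et ord_max * e ord_max * incl (coef true true a).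
Proof.
have coef_inj (a1 a2 : Cl K n.+1) :
    (forall t s, coef t s a1 = coef t s a2) -> a1 = a2.
  move=> E; apply/ffunP => U; have [t [s [S ->]]] := embed_surj U.
  by have /ffunP/(_ S) := E t s; rewrite !ffunE.
by apply: coef_inj => -[] [] /=; rewrite coef_decomp.
Qed.

End Split.

(* The isomorphism F_n.  The coefficients A_ij of a are uniquely determined;
   F_decomp is the recursion in its usual form. *)
Lemma pow2D n : (2 ^ n + 2 ^ n = 2 ^ n.+1)%N.
Proof. by rewrite addnn -mul2n expnS. Qed.

Fixpoint F n : Cl K n -> 'M[K]_(2 ^ n) :=
  match n with
  | 0 => fun a => (a set0)%:M
  | n'.+1 => fun a =>
      let A00 := coef false false a in let A01 := coef false true a in
      let A10 := coef true false a in let A11 := coef true true a in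
      castmx (pow2D n', pow2D n')
        (block_mx (F (A00 + A11)) (F (alpha (A01 + A10)))
                  (F (A01 - A10)) (F (alpha (A00 - A11))))
  end.

Lemma F0 (c : K) : F (c%:A : Cl K 0) = c%:M.
Proof. by rewrite /= !ffunE eqxx /GRing.scale /= mulr1. Qed.

Lemma F_decomp n (A00 A01 A10 A11 : Cl K n) :
  F (incl A00 + e ord_max * incl A01 + et ord_max * incl A10
     + et ord_max * e ord_max * incl A11) =
  castmx (pow2D n, pow2D n)
    (block_mx (F (A00 + A11)) (F (alpha (A01 + A10)))
              (F (A01 - A10)) (F (alpha (A00 - A11)))).
Proof. by rewrite /= !coef_decomp. Qed.

Fixpoint Finv n : 'M[K]_(2 ^ n) -> Cl K n :=
  match n with
  | 0 => fun M => (M 0 0)%:A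
  | n'.+1 => fun M =>
      let M' := castmx (esym (pow2D n'), esym (pow2D n')) M in
      let X00 := Finv (ulsubmx M') in let X01 := alpha (Finv (ursubmx M')) in
      let X10 := Finv (dlsubmx M') in let X11 := alpha (Finv (drsubmx M')) in
      incl (2%:R^-1 *: (X00 + X11)) + e ord_max * incl (2%:R^-1 *: (X01 + X10))
      + et ord_max * incl (2%:R^-1 *: (X01 - X10))
      + et ord_max * e ord_max * incl (2%:R^-1 *: (X00 - X11))
  end.

Hypothesis charK : 2%N \notin [pchar K].

Let two_neq0 : 2%:R != 0 :> K.
Proof. by move: charK; rewrite inE. Qed.

Let half2 n (a : Cl K n) : 2%:R^-1 *: (a + a) = a.
Proof. by rewrite -mulr2n -scaler_nat scalerA mulVf ?scale1r. Qed.

Let addhalf n (a b : Cl K n) : 2%:R^-1 *: (a + b + (a - b)) = a.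
Proof. by rewrite addrACA subrr addr0 half2. Qed.

Let subhalf n (a b : Cl K n) : 2%:R^-1 *: (a + b - (a - b)) = b.
Proof. by rewrite opprB [b - a]addrC addrACA subrr add0r half2. Qed.

Let halfD n (a b : Cl K n) : 2%:R^-1 *: (a + b) + 2%:R^-1 *: (a - b) = a.
Proof. by rewrite -scalerDr addhalf. Qed.

Let halfB n (a b : Cl K n) : 2%:R^-1 *: (a + b) - 2%:R^-1 *: (a - b) = b.
Proof. by rewrite -scalerBr subhalf. Qed.

Lemma FK n : cancel (@F n) (@Finv n).
Proof.
elim: n => [|n IHn] a.
  apply/ffunP => S; rewrite /= !mxE eqxx mulr1n !ffunE.
  have -> : S = set0 by apply/setP => -[].
  by rewrite eqxx /GRing.scale /= mulr1.
rewrite [RHS]coefK /= castmxK block_mxKul block_mxKur block_mxKdl block_mxKdr.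
by rewrite !IHn !alphaK !addhalf !subhalf.
Qed.

Lemma FinvK n : cancel (@Finv n) (@F n).
Proof.
elim: n => [|n IHn] M.
  apply/matrixP => i j; rewrite /= !mxE !ffunE eqxx /GRing.scale /= mulr1.
  by rewrite !ord1.
rewrite [Finv _]/= F_decomp !halfD !halfB !alphaK !IHn.
by rewrite -[RHS](castmxKV (pow2D n) (pow2D n)); congr castmx;
   rewrite -[RHS]submxK.
Qed.

Definition betahat n (M : 'M[K]_(2 ^ n)) : 'M[K]_(2 ^ n) :=
  F (beta (Finv M)).

End SplitSignature.

Arguments e {K n} i.
Arguments et {K n} i.
Arguments F {K n} a.
Arguments Finv {K n} M.
Arguments betahat {K n} M.

(* Programs manipulating matrices with entries in a field.  A program is a
   single finite text, independent of the field and of the size of its input;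
   its loops are bounded, so that it always terminates.  Only the instructions
   acting on matrix entries have a cost: loop control and the computation of
   row and column indices by natural number arithmetic are free. *)

Inductive iexpr :=
  | Ivar of nat
  | Icst of nat
  | Iadd of iexpr & iexpr
  | Isub of iexpr & iexpr
  | Imul of iexpr & iexpr
  | Idiv of iexpr & iexpr
  | Imod of iexpr & iexpr.

(* An entry: array, row, column. *)
Definition entry := (nat * iexpr * iexpr)%type.

Inductive instr :=
  | Move of entry & entry
  | ChangeSign of entry
  | Add of entry & entry & entry
  | Sub of entry & entry & entry
  | Mul of entry & entry & entry
  | Div of entry & entry & entry.

(* If p c1 c2 executes c1 when p is nonzero; For x p c executes c with the
   index variable x set to 0, ..., p - 1, where p is evaluated on entry. *)
Inductive program :=
  | Skip
  | Exec of instr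
  | Assign of nat & iexpr
  | Seq of program & program
  | If of iexpr & program & program
  | For of nat & iexpr & program.

Fixpoint ieval (rho : nat -> nat) (p : iexpr) : nat :=
  match p with
  | Ivar x => rho x
  | Icst c => c
  | Iadd p q => ieval rho p + ieval rho q
  | Isub p q => ieval rho p - ieval rho q
  | Imul p q => ieval rho p * ieval rho q
  | Idiv p q => ieval rho p %/ ieval rho q
  | Imod p q => ieval rho p %% ieval rho q
  end%N.

Section Semantics.

Variable K : fieldType.

Record state := State {
  index : nat -> nat;
  memory : nat -> nat -> nat -> K; (* array, row, column *)
  cost : nat
}.

Definition set_index (x v : nat) (s : state) : state :=
  State (fun y => if y == x then v else index s y) (memory s) (cost s).

Definition read (s : state) (l : entry) : K :=
  memory s l.1.1 (ieval (index s) l.1.2) (ieval (index s) l.2).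

(* A write is the result of one operation. *)
Definition write (s : state) (l : entry) (v : K) : state :=
  State (index s)
    (fun x i j => if [&& x == l.1.1, i == ieval (index s) l.1.2
                       & j == ieval (index s) l.2]
                  then v else memory s x i j)
    (cost s).+1.

Definition step (c : instr) (s : state) : state :=
  match c with
  | Move d l => write s d (read s l)
  | ChangeSign d => write s d (- read s d)
  | Add d l r => write s d (read s l + read s r)
  | Sub d l r => write s d (read s l - read s r)
  | Mul d l r => write s d (read s l * read s r)
  | Div d l r => write s d (read s l / read s r)
  end.

Fixpoint exec (p : program) (s : state) : state :=
  match p with
  | Skip => s
  | Exec c => step c s
  | Assign x q => set_index x (ieval (index s) q) s
  | Seq p1 p2 => exec p2 (exec p1 s)
  | If q p1 p2 => if ieval (index s) q != 0%N then exec p1 s else exec p2 s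
  | For x q p1 => foldl (fun s' v => exec p1 (set_index x v s')) s
                        (iota 0 (ieval (index s) q))
  end.

(* Array x holds the matrix M in its top left corner. *)
Definition holds (s : state) (x k : nat) (M : 'M[K]_k) : Prop :=
  forall i j : 'I_k, memory s x i j = M i j.

(* Initially array 0 holds the input, index variable 0 holds n, and everything
   else is zero. *)
Definition init (n k : nat) (M : 'M[K]_k) : state :=
  State (fun y => if y == 0%N then n else 0%N)
    (fun x i j =>
       match insub i, insub j with
       | Some i', Some j' => if x == 0%N then M i' j' else 0
       | _, _ => 0
       end)
    0.

Lemma init_holds n k (M : 'M[K]_k) : holds (init n M) 0 M.
Proof. by move=> i j; rewrite /= !valK. Qed.

End Semantics.

(* Main.v *)
(** Both [beta \o reversal] and the transpose are antiautomorphisms; comparing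
    the blocks of the recursion for [F] shows by induction on n that they
    correspond under [F].

    For the algorithm, the same recursion shows that reversal acts on matrices
    as a signed transpose along the antidiagonal: the (i, j) entry of [F a^*] is
      (-1) ^ (t i + t j) * (F a) (2^n - 1 - j, 2^n - 1 - i),
    where t i is the sum of n - 1 - k over the bits k set in i, since alpha
    multiplies the (i, j) entry by -1 to the number of bits set in i and
    in j.  As t only concerns indices, each entry costs one move and at most
    one sign change: at most 2 * 4^n operations in all. *)

Require Import Defs.
From mathcomp Require Import all_boot all_order all_algebra.

Set Implicit Arguments.
Unset Strict Implicit.
Unset Printing Implicit Defensive.

Import GRing.Theory.
Local Open Scope ring_scope.

(** * Relations between parity, [beta] and reversal *)

Section Involutions.

Variables (K : fieldType) (m : nat).
Implicit Types a b : cliff K m.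

Lemma betaK : involutive (@beta K m).
Proof.
move=> a; have := cliff_ext_unique (@beta K m \o @beta K m) a => /= ->.
rewrite [RHS](cliff_ext_unique idfun); apply: eq_bigr => S _; congr (_ *: _).
apply: eq_bigr => i _; rewrite /= beta_gen; case: ifP => oi.
  by rewrite raddfN /= beta_gen oi opprK.
by rewrite beta_gen oi.
Qed.

Lemma alpha_beta a : alpha (beta a) = beta (alpha a).
Proof.
have := cliff_ext_unique (@alpha K m \o @beta K m) a => /= ->.
have := cliff_ext_unique (@beta K m \o @alpha K m) a => /= ->.
apply: eq_bigr => S _; congr (_ *: _); apply: eq_bigr => i _ /=.
rewrite alpha_gen raddfN /= beta_gen; case: ifP => _; last exact: alpha_gen.
by rewrite raddfN /= alpha_gen.
Qed.

Lemma reversal_prod I (r : seq I) (P : pred I) (x : I -> cliff K m) :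
  reversal (\prod_(i <- r | P i) x i) = \prod_(i <- rev r | P i) reversal (x i).
Proof.
elim: r => [|i r IHr]; first by rewrite !big_nil reversal1.
rewrite rev_cons -cats1 big_cat /= !big_cons big_nil.
by case: ifP => _; rewrite ?reversalM IHr ?mulr1.
Qed.

Lemma reversal_blade S :
  reversal (blade S) = \prod_(i <- enum 'I_m | i \in S) gen i :> cliff K m.
Proof.
rewrite blade_prod reversal_prod /ords_desc revK.
by apply: eq_bigr => i _; rewrite reversal_gen.
Qed.

(** Takes the place of [cliff_ext_unique] for maps that involve [reversal] and so are not algebra
    morphisms. *)
Lemma linear_blade_ext (V : lmodType K) (f g : {linear cliff K m -> V}) :
  (forall S, f (blade S) = g (blade S)) -> f =1 g.
Proof.
move=> fg a; rewrite (cliffE a) !linear_sum; apply: eq_bigr => S _.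
by rewrite !linearZ /= fg.
Qed.

Lemma alpha_reversal a : alpha (reversal a) = reversal (alpha a).
Proof.
apply: (linear_blade_ext (f := @alpha K m \o @reversal K m)
                         (g := @reversal K m \o @alpha K m)) => S /=.
rewrite reversal_blade rmorph_prod [alpha _]cliff_ext_blade reversal_prod.
rewrite /ords_desc revK; apply: eq_bigr => i _ /=.
by rewrite alpha_gen raddfN /= reversal_gen.
Qed.

End Involutions.

(** Settles the base case of the inductions on n: the only blade of [Cl K 0] is 1. *)
Lemma linear_cliff0 (K : fieldType) (f : {linear cliff K 0 -> cliff K 0}) :
  f 1 = 1 -> f =1 id.
Proof.
move=> f1; apply: (@linear_blade_ext K 0 (cliff K 0) f idfun) => S.
by have -> : S = set0 by apply/setP => -[].
Qed.

(** * Morphisms and antimorphisms on decompositions, over abstract rings *)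

Section GenericDecomposition.

Variables (R S : pzRingType) (inc : {additive R -> S}).

Lemma morph_decompNN (f : {rmorphism S -> S}) (f0 : R -> R) x y a b c d :
    (forall r, f (inc r) = inc (f0 r)) -> f x = - x -> f y = - y ->
  f (inc a + x * inc b + y * inc c + y * x * inc d) =
    inc (f0 a) + x * inc (- f0 b) + y * inc (- f0 c) + y * x * inc (f0 d).
Proof.
move=> f_inc fx fy; rewrite !rmorphD !rmorphM /= !f_inc fx fy !raddfN.
by rewrite mulrNN !mulNr !mulrN.
Qed.

Variables (g : {additive S -> S}) (al g0 : R -> R) (x y : S).
Hypothesis gM : forall u v, g (u * v) = g v * g u.
Hypothesis g_inc : forall r, g (inc r) = inc (g0 r).
Hypothesis gx : g x = x.
Hypothesis inc_x : forall r, inc r * x = x * inc (al r).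
Hypothesis inc_y : forall r, inc r * y = y * inc (al r).
Hypothesis alK : involutive al.
Hypothesis xy : x * y = - (y * x).

(** After g reverses each product, moving the coefficient back to the right costs one [al] past x or
    y, and two, which cancel, past both. The sign of d comes from $g(yx) = xy = -yx$; when $g(y) =
    -y$, as in [antimorph_decompN], it cancels. *)
Lemma antimorph_decompP a b c d : g y = y ->
  g (inc a + x * inc b + y * inc c + y * x * inc d) =
    inc (g0 a) + x * inc (al (g0 b)) + y * inc (al (g0 c))
    + y * x * inc (- g0 d).
Proof.
move=> gy; rewrite !raddfD /= !gM !g_inc gx gy inc_x inc_y raddfN.
by rewrite mulrA inc_x -mulrA inc_y mulrA alK xy mulNr mulrN.
Qed.

Lemma antimorph_decompN a b c d : g y = - y ->
  g (inc a + x * inc b + y * inc c + y * x * inc d) =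
    inc (g0 a) + x * inc (al (g0 b)) + y * inc (- al (g0 c))
    + y * x * inc (g0 d).
Proof.
move=> gy; rewrite !raddfD /= !gM !g_inc gx gy !mulrN inc_x inc_y raddfN.
by rewrite mulrA inc_x -mulrA inc_y mulrA alK xy !mulNr mulrN opprK.
Qed.

End GenericDecomposition.

(** * The involutions on the four coefficients of an element of $Cl(n+1,n+1)$ *)

Section Recursion.

Variables (K : fieldType) (n : nat).
Implicit Types a b c d : Cl K n.

Lemma alpha_incl a : alpha (incl a) = incl (alpha a).
Proof.
have := cliff_ext_unique (@alpha K n.+1.*2 \o @incl K n) a => /= ->.
have := cliff_ext_unique (@incl K n \o @alpha K n.*2) a => /= ->.
apply: eq_bigr => S _; congr (_ *: _); apply: eq_bigr => i _ /=.
by rewrite alpha_gen raddfN /= incl_gen alpha_gen.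
Qed.

Lemma beta_incl a : beta (incl a) = incl (beta a).
Proof.
have := cliff_ext_unique (@beta K n.+1.*2 \o @incl K n) a => /= ->.
have := cliff_ext_unique (@incl K n \o @beta K n.*2) a => /= ->.
apply: eq_bigr => S _; congr (_ *: _); apply: eq_bigr => i _ /=.
by rewrite incl_gen !beta_gen /=; case: odd; rewrite ?raddfN /= ?incl_gen.
Qed.

Lemma reversal_incl a : reversal (incl a) = incl (reversal a).
Proof.
apply: (linear_blade_ext (f := @reversal K n.+1.*2 \o @incl K n)
                         (g := @incl K n \o @reversal K n.*2)) => S /=.
rewrite reversal_blade rmorph_prod [incl (blade S)]cliff_ext_blade.
rewrite reversal_prod /ords_desc revK; apply: eq_bigr => i _ /=.
by rewrite reversal_gen incl_gen.
Qed.

(** Moving v past a blade costs one sign per factor, which is the sign of the blade under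
    [alpha]. *)
Lemma incl_mul_anticomm (v : Cl K n.+1) a :
    (forall i, gen (ord_up i) * v = - (v * gen (ord_up i))) ->
  incl a * v = v * incl (alpha a).
Proof.
move=> vanti.
have alphaZ k b : alpha (k *: b) = k *: alpha b by apply: linearZ.
have inclZ k b : incl (k *: b) = k *: incl b by apply: linearZ.
rewrite (cliffE a) (linear_sum alpha) !(linear_sum (@incl K n)) mulr_suml.
rewrite mulr_sumr; apply: eq_bigr => S _ /=.
rewrite alphaZ !inclZ -scalerAl -scalerAr; congr (_ *: _).
rewrite blade_prod !rmorph_prod /=.
elim: (ords_desc _) => [|i r IHr]; first by rewrite !big_nil mulr1 mul1r.
rewrite !big_cons; case: ifP => _ //.
rewrite -mulrA IHr mulrA incl_gen vanti alpha_gen raddfN /= incl_gen.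
by rewrite !mulNr mulrN mulrA.
Qed.

Lemma incl_mul_e a :
  incl a * e ord_max = e ord_max * incl (alpha a) :> Cl K n.+1.
Proof.
apply: incl_mul_anticomm => i; apply: gen_anticomm.
by rewrite -val_eqE /= ltn_eqF.
Qed.

Lemma incl_mul_et a :
  incl a * et ord_max = et ord_max * incl (alpha a) :> Cl K n.+1.
Proof.
apply: incl_mul_anticomm => i; apply: gen_anticomm.
by rewrite -val_eqE /= ltn_eqF // ltnS ltnW.
Qed.

Local Notation decomp a b c d :=
  (incl a + e ord_max * incl b + et ord_max * incl c
   + et ord_max * e ord_max * incl d).

Lemma alpha_decomp a b c d :
  alpha (decomp a b c d) =
    decomp (alpha a) (- alpha b) (- alpha c) (alpha d).
Proof.
apply: (@morph_decompNN _ _ (@incl K n) (@alpha K n.+1.*2) (@alpha K n.*2)).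
- exact: alpha_incl.
- exact: alpha_e.
- exact: alpha_et.
Qed.

Lemma beta_reversal_decomp a b c d :
  beta (reversal (decomp a b c d)) =
    decomp (beta (reversal a)) (alpha (beta (reversal b)))
           (- alpha (beta (reversal c))) (beta (reversal d)).
Proof.
apply: (@antimorph_decompN _ _ (@incl K n)
  (@beta K n.+1.*2 \o @reversal K n.+1.*2) (@alpha K n.*2)
  (@beta K n.*2 \o @reversal K n.*2)) => /=.
- by move=> x y; rewrite reversalM; apply: rmorphM.
- by move=> x; rewrite reversal_incl beta_incl.
- by rewrite reversal_e beta_e.
- exact: incl_mul_e.
- exact: incl_mul_et.
- exact: alphaK.
- exact: e_et_anticomm.
- by rewrite reversal_et beta_et.
Qed.

Lemma reversal_decomp a b c d :
  reversal (decomp a b c d) =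
    decomp (reversal a) (alpha (reversal b)) (alpha (reversal c))
           (- reversal d).
Proof.
apply: (@antimorph_decompP _ _ (@incl K n) (@reversal K n.+1.*2)
  (@alpha K n.*2) (@reversal K n.*2)) => /=.
- exact: reversalM.
- exact: reversal_incl.
- exact: reversal_e.
- exact: incl_mul_e.
- exact: incl_mul_et.
- exact: alphaK.
- exact: e_et_anticomm.
- exact: reversal_et.
Qed.

End Recursion.

(** * Parities of weighted bit sums, and block indices *)

(* The parity of [bitwt w n i] is that of the sum of the weights [w k] of the
   bits k < n set in i. *)
Definition bitwt (w : nat -> nat) (n i : nat) : nat :=
  \sum_(k < n) w k * (i %/ 2 ^ k).

(** For k < n, adding $2^n$ changes the quotient by $2^k$ by the even number $2^{n-k}$. *)
Lemma odd_bitwt_add w n i : odd (bitwt w n (2 ^ n + i)) = odd (bitwt w n i).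
Proof.
rewrite /bitwt !(big_morph odd oddD (erefl _)); apply: eq_bigr => k _.
have lekn := ltn_ord k; rewrite !oddM; congr (_ && _).
rewrite (_ : 2 ^ n = 2 ^ (n - k) * 2 ^ k)%N; last by rewrite -expnD subnK // ltnW.
rewrite divnMDl ?expn_gt0 // oddD oddX /= orbF.
by rewrite subn_eq0 leqNgt lekn.
Qed.

Definition popcount n i : nat := bitwt (fun=> 1%N) n i.
Definition revexp n i : nat := bitwt (fun k => n - k.+1)%N n i.

(** Passing from n to n + 1 raises the weight of each lower bit by one and gives the new top bit
    weight 0. The increment is the sign exponent of one more [alpha]. *)
Lemma revexpS n i : revexp n.+1 i = (popcount n i + revexp n i)%N.
Proof.
rewrite /revexp /popcount /bitwt big_ord_recr /= subnn mul0n addn0 -big_split.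
by apply: eq_bigr => k _; rewrite /= -mulnDl add1n subnSK.
Qed.

Lemma odd_bitwt w n (b : bool) i :
  odd (bitwt w n ((if b then 2 ^ n else 0) + i)%N) = odd (bitwt w n i).
Proof. by case: b; rewrite ?odd_bitwt_add. Qed.

Lemma odd_popcountS n (b : bool) (i : 'I_(2 ^ n)) :
  odd (popcount n.+1 ((if b then 2 ^ n else 0) + i)%N) = b (+) odd (popcount n i).
Proof.
have -> k : popcount n.+1 k = (popcount n k + k %/ 2 ^ n)%N.
  by rewrite /popcount /bitwt big_ord_recr /= mul1n.
rewrite oddD odd_bitwt addbC; congr (_ (+) _); case: b => /=.
  by rewrite divnDl ?dvdnn // divnn expn_gt0 divn_small.
by rewrite add0n divn_small.
Qed.

Lemma odd_revexpS n (b : bool) i :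
  odd (revexp n.+1 ((if b then 2 ^ n else 0) + i)%N) =
    odd (popcount n i) (+) odd (revexp n i).
Proof. by rewrite revexpS oddD !odd_bitwt. Qed.

(** The leading bit b selects a half of the rows or columns, so that the quadrant of an entry is a
    pair of booleans. *)
Definition blk n (b : bool) (i : 'I_(2 ^ n)) : 'I_(2 ^ n.+1) :=
  cast_ord (pow2D n) (if b then rshift _ i else lshift _ i).

Lemma val_blk n b (i : 'I_(2 ^ n)) :
  blk b i = ((if b then 2 ^ n else 0) + i)%N :> nat.
Proof. by case: b. Qed.

Lemma blkP n (i : 'I_(2 ^ n.+1)) : exists b i', i = blk b i'.
Proof.
rewrite -[i](cast_ordKV (pow2D n)).
move: (cast_ord (esym (pow2D n)) i) => k.
by case: (split_ordP k) => i' ->; [exists false | exists true]; exists i'.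
Qed.

Lemma rev_blk n b (i : 'I_(2 ^ n)) : rev_ord (blk b i) = blk (~~ b) (rev_ord i).
Proof.
have lti := ltn_ord i; apply: val_inj; rewrite [RHS]val_blk.
transitivity (2 ^ n.+1 - (blk b i).+1)%N => //; rewrite val_blk -pow2D.
case: b => /=; first by rewrite -addnS subnDl.
by rewrite add0n addnBA.
Qed.

(** * Identities between the arguments of the blocks *)

Section GenericBlocks.

(* The blocks of F_decomp for the coefficients of alpha a, beta (reversal a) and
   reversal a, where x and y are two coefficients of a, and ga is
   [beta \o reversal] resp. [reversal]. *)
Variables (V : zmodType) (al ga : {additive V -> V}).
Hypothesis alK : involutive al.
Hypothesis al_ga : forall x, al (ga x) = ga (al x).

Lemma alpha_blocks x y :
  [/\ al x + al y = al (x + y), al (- al x - al y) = - al (al (x + y)),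
      - al x - - al y = - al (x - y) & al (al x - al y) = al (al (x - y))].
Proof. by split; rewrite ?opprK !(raddfB, raddfD, raddfN) ?opprD ?opprK. Qed.

Lemma transpose_blocks x y :
  [/\ al (al (ga x) - al (ga y)) = ga (x - y),
      al (ga x) - - al (ga y) = ga (al (x + y))
    & al (ga x - ga y) = ga (al (x - y))].
Proof. by split; rewrite ?opprK !(raddfB, raddfD) /= ?alK ?al_ga. Qed.

Lemma reversal_blocks x y :
  [/\ ga x - ga y = al (ga (al (x - y))),
      al (al (ga x) + al (ga y)) = al (ga (al (x + y))),
      al (ga x) - al (ga y) = al (ga (x - y))
    & al (ga x - - ga y) = al (ga (x + y))].
Proof. by split; rewrite ?opprK !(raddfB, raddfD) /= -?al_ga ?alK. Qed.

End GenericBlocks.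

(** * Transpose, parity and reversal on matrix entries *)

Section Entries.

Variable K : fieldType.

Lemma block_blk n (A B C D : 'M[K]_(2 ^ n)) bi bj i j :
  castmx (pow2D n, pow2D n) (block_mx A B C D) (blk bi i) (blk bj j) =
    (if bi then if bj then D else C else if bj then B else A) i j.
Proof.
rewrite castmxE !cast_ordK.
by case: bi; case: bj;
   rewrite ?block_mxEul ?block_mxEur ?block_mxEdl ?block_mxEdr.
Qed.

Lemma F_decomp_blk n (A B C D : Cl K n) bi bj i j :
  F (incl A + e ord_max * incl B + et ord_max * incl C
     + et ord_max * e ord_max * incl D) (blk bi i) (blk bj j) =
    if bi then if bj then F (alpha (A - D)) i j else F (B - C) i j
    else if bj then F (alpha (B + C)) i j else F (A + D) i j.
Proof. by rewrite F_decomp block_blk; case: bi; case: bj. Qed.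

Lemma F_blk n (a : Cl K n.+1) bi bj i j :
  let A := coef false false a in let B := coef false true a in
  let C := coef true false a in let D := coef true true a in
  F a (blk bi i) (blk bj j) =
    if bi then if bj then F (alpha (A - D)) i j else F (B - C) i j
    else if bj then F (alpha (B + C)) i j else F (A + D) i j.
Proof. by rewrite /= block_blk; case: bi; case: bj. Qed.

(** The coefficients b and c become $\alpha(g(b))$ and $-\alpha(g(c))$ for $g = \beta \circ {}^*$.
    The relative sign exchanges the roles of $b + c$ and $b - c$, hence the off-diagonal blocks, as
    the transpose does. *)
Lemma F_transpose n (a : Cl K n) : (F a)^T = F (beta (reversal a)).
Proof.
elim: n a => [|n IHn] a.
  have g1 : beta (reversal 1) = 1 :> cliff K 0 by rewrite reversal1 rmorph1.
  have -> : beta (reversal a) = a.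
    exact: (linear_cliff0 (f := @beta K 0 \o @reversal K 0) g1 a).
  by apply/matrixP => i j; rewrite /= !mxE eq_sym.
rewrite [in RHS](Defs.coefK a) beta_reversal_decomp F_decomp /=.
set A := coef false false a; set B := coef false true a.
set C := coef true false a; set D := coef true true a.
have gaC (b : Cl K n) : alpha (beta (reversal b)) = beta (reversal (alpha b)).
  by rewrite alpha_beta alpha_reversal.
have blocks := @transpose_blocks _ (@alpha K n.*2)
  (@beta K n.*2 \o @reversal K n.*2) (@alphaK K n.*2) gaC.
rewrite trmx_cast tr_block_mx !IHn; congr castmx; congr block_mx; congr F.
- exact: (raddfD (@beta K n.*2 \o @reversal K n.*2)).
- by have [/= <- _ _] := blocks B C.
- have [_ /= E _] := blocks B C; exact: (esym E).
- by have [_ _ /= <-] := blocks A D.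
Qed.

(** Pulls out the signs that [alpha] puts on the off-diagonal blocks. *)
Lemma F_opp n (a : Cl K n) : F (- a) = - F a.
Proof.
elim: n a => [|n IHn] a; first by rewrite /= ffunE raddfN.
apply/matrixP => i j; have [bi [i' ->]] := blkP i; have [bj [j' ->]] := blkP j.
have F_oppE (b : Cl K n) : F (- b) i' j' = - F b i' j' by rewrite IHn mxE.
have F_alphaN (b : Cl K n) : F (alpha (- b)) i' j' = - F (alpha b) i' j'.
  by rewrite raddfN IHn mxE.
rewrite [LHS]F_blk [in RHS]mxE [in RHS](F_blk a bi bj i' j').
rewrite !(raddfN (coef _ _)) -!opprD.
case: bi; case: bj.
- exact: F_alphaN.
- exact: F_oppE.
- exact: F_alphaN.
- exact: F_oppE.
Qed.

(** [alpha] acts within each block and also negates the blocks where the leading bits of i and j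
    differ, since their coefficients come with a single [e] or [et]. *)
Lemma F_alpha n (a : Cl K n) i j :
  F (alpha a) i j = (-1) ^+ (popcount n i + popcount n j) * F a i j.
Proof.
rewrite -signr_odd oddD; elim: n a i j => [|n IHn] a i j.
  have -> : alpha a = a := linear_cliff0 (f := @alpha K 0) (rmorph1 (@alpha K 0)) a.
  by rewrite /popcount /bitwt !big_ord0 /= expr0 mul1r.
rewrite [in LHS](Defs.coefK a) alpha_decomp.
set A := coef false false a; set B := coef false true a.
set C := coef true false a; set D := coef true true a.
have [bi [i' ->]] := blkP i; have [bj [j' ->]] := blkP j.
have blocks := @alpha_blocks _ (@alpha K n.*2).
rewrite [LHS]F_decomp_blk [in RHS](F_blk a bi bj i' j') !val_blk !odd_popcountS.
have [E00 _ _ E11] := blocks A D; have [_ E01 E10 _] := blocks B C.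
have sign (b : bool) (x : K) :
    (-1) ^+ (b (+) (odd (popcount n i') (+) odd (popcount n j'))) * x =
    (-1) ^+ b * ((-1) ^+ (odd (popcount n i') (+) odd (popcount n j')) * x).
  by rewrite signr_addb mulrA.
(* Separates the sign of the leading bits from that of the lower ones. *)
rewrite addbACA sign; case: bi; case: bj.
- by rewrite [in LHS]E11 [LHS]IHn expr0 mul1r.
- by rewrite [in LHS]E10 F_opp [LHS]mxE [in LHS]IHn expr1 mulN1r.
- by rewrite [in LHS]E01 F_opp [LHS]mxE [in LHS]IHn expr1 mulN1r.
- by rewrite [in LHS]E00 [LHS]IHn expr0 mul1r.
Qed.

Lemma F_reversal n (a : Cl K n) i j :
  F (reversal a) i j =
    (-1) ^+ (revexp n i + revexp n j) * F a (rev_ord j) (rev_ord i).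
Proof.
rewrite -signr_odd oddD; elim: n a i j => [|n IHn] a i j.
  have -> : reversal a = a := linear_cliff0 (f := @reversal K 0) (reversal1 K 0) a.
  by rewrite /revexp /bitwt !big_ord0 /= expr0 mul1r !ord1.
rewrite [in LHS](Defs.coefK a) reversal_decomp.
set A := coef false false a; set B := coef false true a.
set C := coef true false a; set D := coef true true a.
have [bi [i' ->]] := blkP i; have [bj [j' ->]] := blkP j.
have blocks := @reversal_blocks _ (@alpha K n.*2) (@reversal K n.*2)
  (@alphaK K n.*2) (@alpha_reversal K n.*2).
rewrite !rev_blk [LHS]F_decomp_blk [in RHS](F_blk a (~~ bj) (~~ bi)).
rewrite !val_blk !odd_revexpS.
have [E00 _ _ _] := blocks A D; have [_ E01 _ _] := blocks B C.
have [_ _ E10 _] := blocks B C; have [_ _ _ E11] := blocks A D.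
have entry (X : Cl K n) :
    F (alpha (reversal X)) i' j' =
    (-1) ^+ (odd (popcount n i') (+) odd (revexp n i')
             (+) (odd (popcount n j') (+) odd (revexp n j')))
      * F X (rev_ord j') (rev_ord i').
  by rewrite F_alpha IHn mulrA -signr_odd oddD -signr_addb addbACA.
case: bi; case: bj.
- rewrite [in LHS]E11; exact: entry.
- rewrite [in LHS]E10; exact: entry.
- rewrite [in LHS]E01; exact: entry.
- rewrite [in LHS]E00; exact: entry.
Qed.

End Entries.

(** * The program for reversal *)

(* Index variables: 0 holds n, 1 holds 2 ^ n, 3 and 4 the row i and column j of
   the output entry, 5 and 6 the quotients of i and j by 2 ^ k, 7 the partial
   sums of [revexp n i + revexp n j]; 2 and 8 are loop counters. *)
Definition halve x := Assign x (Idiv (Ivar x) (Icst 2)).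

Definition sign_step : program :=
  Seq (Assign 7 (Iadd (Ivar 7) (Imul (Isub (Ivar 0) (Iadd (Ivar 8) (Icst 1)))
                                     (Iadd (Ivar 5) (Ivar 6)))))
      (Seq (halve 5) (halve 6)).

Definition sign_exponent : program :=
  Seq (Assign 5 (Ivar 3)) (Seq (Assign 6 (Ivar 4)) (Seq (Assign 7 (Icst 0))
    (For 8 (Ivar 0) sign_step))).

(** The value of [rev_ord] at the index held in x. *)
Definition from_end x := Isub (Ivar 1) (Iadd (Ivar x) (Icst 1)).

(** Writing to array 1 keeps the input in array 0 intact for later reads. *)
Definition reversal_entry : program :=
  Seq (Exec (Move (1, Ivar 3, Ivar 4) (0, from_end 4, from_end 3)))
    (Seq sign_exponent
      (If (Imod (Ivar 7) (Icst 2)) (Exec (ChangeSign (1, Ivar 3, Ivar 4))) Skip)).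

Definition reversal_program : program :=
  Seq (Seq (Assign 1 (Icst 1))
           (For 2 (Ivar 0) (Assign 1 (Imul (Ivar 1) (Icst 2)))))
      (For 3 (Ivar 1) (For 4 (Ivar 1) reversal_entry)).

(** * Correctness and cost of the program *)

Section ProgramCorrectness.

Variable K : fieldType.
Implicit Types s : state K.

Local Notation ixv := Defs.index.

(** Invariant rule for loops: [inv v] describes the state before pass v. The number of passes is
    fixed by the initial state. *)
Lemma exec_For (inv : nat -> state K -> Prop) x q p s :
    inv 0%N s ->
    (forall v s', (v < ieval (ixv s) q)%N -> inv v s' ->
       inv v.+1 (exec p (set_index x v s'))) ->
  inv (ieval (ixv s) q) (exec (For x q p) s).
Proof.
move=> inv0 invS /=; move: (ieval _ _) invS => m invS.
(* Induction on the number k of passes done, the bound m staying fixed. *)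
have: (m <= m)%N by []; move: {-2}m => k; elim: k => // k IHk ltkm.
rewrite -addn1 iotaD foldl_cat /= add0n addn1; apply: invS => //.
exact/IHk/ltnW.
Qed.

Lemma power_loop_correct n s (s' := exec (Seq (Assign 1 (Icst 1))
    (For 2 (Ivar 0) (Assign 1 (Imul (Ivar 1) (Icst 2))))) s) :
    ixv s 0%N = n ->
  [/\ ixv s' 0%N = n, ixv s' 1%N = (2 ^ n)%N, memory s' = memory s
    & cost s' = cost s].
Proof.
move=> s0; pose s1 := exec (Assign 1 (Icst 1)) s.
have := @exec_For (fun k t => [/\ ixv t 0%N = n, ixv t 1%N = (2 ^ k)%N,
  memory t = memory s & cost t = cost s]) 2 (Ivar 0)
  (Assign 1 (Imul (Ivar 1) (Icst 2))) s1.
rewrite [ieval _ _]s0; apply=> // v t _ [t0 t1 tm tc] /=.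
by split; rewrite // t1 expnS mulnC.
Qed.

(** The index variables below 5 belong to the surrounding program; the computation only writes to 5,
    6, 7 and 8. *)
Lemma sign_exponent_correct n i j s (s' := exec sign_exponent s) :
    ixv s 0%N = n -> ixv s 3%N = i -> ixv s 4%N = j ->
  [/\ forall x, (x < 5)%N -> ixv s' x = ixv s x,
      ixv s' 7%N = (revexp n i + revexp n j)%N,
      memory s' = memory s & cost s' = cost s].
Proof.
move=> s0 s3 s4; rewrite {}/s'.
pose s1 := set_index 7 0 (set_index 6 j (set_index 5 i s)).
have -> : exec sign_exponent s = exec (For 8 (Ivar 0) sign_step) s1.
  by rewrite /s1 -s3 -s4.
have := @exec_For (fun k t => [/\ forall x, (x < 5)%N -> ixv t x = ixv s x,
  ixv t 5%N = i %/ 2 ^ k /\ ixv t 6%N = j %/ 2 ^ k,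
  ixv t 7%N = \sum_(l < k) (n - l.+1) * (i %/ 2 ^ l)
                + \sum_(l < k) (n - l.+1) * (j %/ 2 ^ l),
  memory t = memory s & cost t = cost s])%N 8 (Ivar 0) sign_step s1.
rewrite [ieval _ _]s0 => inv; case: inv.
- split=> //; last by rewrite !big_ord0.
  + by move=> x; case: x => [|[|[|[|[|]]]]].
  + by rewrite !divn1.
- move=> v t ltvn [tx [t5 t6] t7 tm tc]; split=> //=.
  + by move=> x; case: x => [|[|[|[|[|]]]]] // _; rewrite -tx.
  + by rewrite t5 t6 expnSr !divnMA.
  + rewrite t5 t6 t7 (tx 0%N) // s0 addn1 !big_ord_recr /= mulnDr.
    by rewrite addnACA.
- by move=> tx _ t7 tm tc; split.
Qed.

Lemma reversal_entry_correct n i j s (s' := exec reversal_entry s) :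
    ixv s 0%N = n -> ixv s 1%N = (2 ^ n)%N ->
    ixv s 3%N = i -> ixv s 4%N = j ->
  [/\ forall x, (x < 5)%N -> ixv s' x = ixv s x,
      forall x a b, memory s' x a b =
        if [&& x == 1, a == i & b == j]%N
        then (-1) ^+ (revexp n i + revexp n j)
               * memory s 0 (2 ^ n - j.+1)%N (2 ^ n - i.+1)%N
        else memory s x a b
    & (cost s' <= cost s + 2)%N].
Proof.
move=> s0 s1 s3 s4.
pose t := step (Move (1, Ivar 3, Ivar 4) (0, from_end 4, from_end 3))%N s.
have [ux u7 um uc] := @sign_exponent_correct n i j t s0 s3 s4.
have tm x a b : memory t x a b =
    if [&& x == 1, a == i & b == j]%N
    then memory s 0 (2 ^ n - j.+1)%N (2 ^ n - i.+1)%N else memory s x a b.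
  by rewrite /= /read /= s1 s3 s4 !addn1.
rewrite {}/s'.
have -> : exec reversal_entry s =
  exec (If (Imod (Ivar 7) (Icst 2)) (Exec (ChangeSign (1, Ivar 3, Ivar 4))) Skip)%N
    (exec sign_exponent t) by [].
move: (exec sign_exponent t) ux u7 um uc => u ux u7 um uc.
rewrite /= u7 modn2 eqb0 negbK -signr_odd.
have u3 : ixv u 3%N = i by rewrite ux.
have u4 : ixv u 4%N = j by rewrite ux.
case: odd; split=> [x ltx|x a b|] /=.
- by rewrite ux.
- rewrite /read /= u3 u4 um !tm !eqxx /= expr1 mulN1r.
  by case: ifP => // ->.
- by rewrite uc /= addn2.
- by rewrite ux.
- by rewrite um tm expr0 mul1r.
- by rewrite uc /= addn2.
Qed.

(* D marks the entries of array 1 already computed. *)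
Record progress n (M0 : nat -> nat -> K) (D : nat -> nat -> bool) c s : Prop := {
  progress_n : ixv s 0%N = n;
  progress_dim : ixv s 1%N = (2 ^ n)%N;
  progress_input : forall a b, memory s 0 a b = M0 a b;
  progress_output : forall a b, D a b ->
    memory s 1 a b =
      (-1) ^+ (revexp n a + revexp n b) * M0 (2 ^ n - b.+1)%N (2 ^ n - a.+1)%N;
  progress_cost : (cost s <= c)%N
}.

Lemma reversal_program_correct n (M : 'M[K]_(2 ^ n))
    (s' := exec reversal_program (init n M)) :
  (forall i j : 'I_(2 ^ n), memory s' 1 i j =
     (-1) ^+ (revexp n i + revexp n j) * M (rev_ord j) (rev_ord i))
  /\ (cost s' <= 2 * 4 ^ n)%N.
Proof.
have [t0 t1 tm tc] := @power_loop_correct n (init n M) erefl.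
rewrite {}/s'; set s' := exec reversal_program (init n M).
set t := exec _ _ in t0 t1 tm tc.
pose M0 := memory (init n M) 0%N; pose N := (2 ^ n)%N.
have P : progress n M0 (fun a b => (a < N) && (b < N))%N (N * (N * 2)) s'.
  have := @exec_For (fun i => progress n M0 (fun a b => (a < i) && (b < N))%N
    (i * (N * 2))) 3 (Ivar 1) (For 4 (Ivar 1) reversal_entry) t.
  rewrite [ieval _ _]t1; apply=> [|i s ltiN [s0 s1 sin sout sc]].
    by split; rewrite ?tm ?tc.
  set s3 := set_index 3 i s.
  (* Rows before i are complete and row i is filled up to column j. The invariant also fixes
     variable 3, from which the body reads the row. *)
  have := @exec_For (fun j u => ixv u 3%N = i /\ progress n M0
    (fun a b => (a < i) && (b < N) || (a == i) && (b < j))%N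
    (i * (N * 2) + j * 2) u) 4 (Ivar 1) reversal_entry s3.
  rewrite [ieval _ _]s1 => inv; case: inv => [|j u ltjN [u3 [u0 u1 uin uout uc]]|].
  - by split=> //; split; rewrite ?addn0 // => a b; rewrite andbF orbF; apply: sout.
  - have [vx vm vc] :=
      @reversal_entry_correct n i j (set_index 4 j u) u0 u1 u3 erefl.
    split; first by rewrite vx.
    split.
    + by rewrite vx.
    + by rewrite vx.
    + by move=> a b; rewrite vm /= uin.
    + move=> a b; rewrite vm /= ltnS (leq_eqVlt b).
      case: (eqVneq a i) => [->|nai] /=; last first.
        by rewrite orbF => Dab; apply: uout; rewrite Dab.
      rewrite ltnn /=; case: (eqVneq b j) => [->|nbj] /=; first by rewrite uin.
      by move=> ltbj; apply: uout; rewrite eqxx ltbj orbT.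
    + by apply: leq_trans vc _; rewrite mulSn [(2 + _)%N]addnC addnA leq_add2r.
  case=> _ [u0 u1 uin uout uc]; split=> //.
  + move=> a b /andP[leai ltbN]; apply: uout; move: leai.
    by rewrite ltnS leq_eqVlt ltbN !andbT orbC.
  + by rewrite mulSn addnC.
split=> [i j|].
  rewrite (progress_output P) ?ltn_ord //; congr (_ * _).
  exact: (init_holds n M (rev_ord j) (rev_ord i)).
apply: leq_trans (progress_cost P) _.
have -> : (4 ^ n = N * N)%N by rewrite /N -expnMn.
by rewrite mulnA mulnC.
Qed.

End ProgramCorrectness.

Theorem mainTheorem7 :
  (forall (K : fieldType) (charK : 2%N \notin [pchar K]) (n : nat)
      (a : Cl K n),
     (F a)^T = F (beta (reversal a))
     /\ F (reversal a) = betahat (F a)^T)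
  /\
  (exists (alg : program) (C : nat),
     forall (K : fieldType) (charK : 2%N \notin [pchar K]) (n : nat)
       (hn : (1 <= n)%N) (a : Cl K n),
       holds (exec alg (init n (F a))) 1 (F (reversal a))
       /\ (cost (exec alg (init n (F a))) <= C * (n * 4 ^ n))%N).
Proof.
split=> [K charK n a|].
  (* The second equality follows from the first, as [Finv] undoes [F] in characteristic other than 2
     and [beta] is an involution. *)
  by rewrite F_transpose /betahat (FK charK) betaK.
exists reversal_program, 2%N => K charK n hn a.
have [out cost_le] := reversal_program_correct (F a).
split=> [i j|]; first by rewrite out F_reversal.
(* Here $n \ge 1$ gives $4^n \le n 4^n$. *)
by apply: leq_trans cost_le _; rewrite leq_mul2l leq_pmull.
Qed.
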